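(* Let $G$ be a transitive permutation group of degree $n$ and rank $r$ on a finite set $\Omega$ (so $|\Omega|=n$). Then $\sigma(G)\le n-r+1$. Moreover, if $\sigma(G)=n-r+1$ and $G$ is not regular, then $G$ admits a system of imprimitivity $\Sigma$ consisting of $r-1$ blocks such that the setwise stabilizer of each block acts $2$-transitively on the block and the induced action of $G$ on $\Sigma$ is regular.
   Context: Let $G$ be a permutation group on a finite set $\Omega$. For $\omega,\omega',\alpha\in\Omega$, $\alpha$ separates $\omega,\omega'$ if $\omega$ and $\omega'$ belong to distinct orbits of the point stabilizer $G_\alpha$. A subset $S\subseteq\Omega$ is separating for $G$ if for any two distinct $\omega,\omega'\in\Omega$ there is $\alpha\in S$ separating $\omega,\omega'$. The orbit dimension $\sigma(G)$ is the minimum cardinality of a separating set for $G$. The rank $r$ of a transitive group $G$ is the number of orbits of $G_\alpha$ on $\Omega$ (independent of $\alpha$). A system of imprimitivity is a $G$-invariant partition of $\Omega$; the trivial partition $\{\Omega\}$ is allowed here (it is the one used when $r=2$). A group acts regularly if it acts transitively and the (induced) permutation group has trivial point stabilizers; thus the action of $G$ on $\Sigma$ being regular means that the permutation group induced by $G$ on $\Sigma$ is regular. *)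

(* Defs.v *)
From mathcomp Require Import all_boot all_fingroup all_solvable.

Set Implicit Arguments.
Unset Strict Implicit.
Unset Printing Implicit Defensive.

Local Open Scope group_scope.

Section OrbitDimension.

Variables (T : finType) (G : {set {perm T}}).

Definition stab_orbit (a w : T) : {set T} := orbit 'P 'C_G[a | 'P] w.

Definition separates (a w w' : T) : bool := stab_orbit a w != stab_orbit a w'.

Definition separating (S : {set T}) : bool :=
  [forall w, forall w', (w != w') ==> [exists a in S, separates a w w']].

(* The value of arg min is meaningful for groups G, where [set: T] is
   separating (lemma separatingT below). *)
Definition orbit_dimension : nat :=
  #|[arg min_(S < [set: T] | separating S) #|S|]|.

(* For transitive G this does not depend on a. *)
Definition rank_at (a : T) : nat := #|[set stab_orbit a w | w : T]|.

Definition regular_on (S : {set T}) : bool :=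
  [transitive G, on S | 'P] && [forall a in S, 'C_G[a | 'P] == 1].

(* Unlike imprimitivity_system of primitive_action, the trivial partitions
   are allowed. *)
Definition invariant_partition (Sigma : {set {set T}}) : bool :=
  partition Sigma [set: T] && [acts G, on Sigma | 'P^*].

End OrbitDimension.

Lemma separatingT (T : finType) (G : {group {perm T}}) : separating G [set: T].
Proof.
apply/forallP => w; apply/forallP => w'; apply/implyP => neq_ww'.
apply/existsP; exists w; rewrite inE /=; apply: contra neq_ww' => /eqP eq_orb.
have : w' \in stab_orbit G w w by rewrite eq_orb; apply: orbit_refl.
case/orbitP => g /setIP[_ /astab1P gw] gww'.
by rewrite -gww' gw.
Qed.

(* The permutations of Sigma induced by G, as permutations of {set T} that fix
   every set outside Sigma. *)
Definition induced_perms (T : finType) (G : {set {perm T}})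
    (Sigma : {set {set T}}) : {set {perm {set T}}} :=
  restr_perm Sigma @* (actperm 'P^* @* G).

(* Main.v *)
Require Import Defs.
From mathcomp Require Import all_boot all_fingroup all_solvable.

(** Fix a point c and choose one representative in each orbit of its
    stabilizer.  The set S formed by c and all the points that are not
    representatives is separating: c separates distinct orbits, two distinct
    points of one orbit cannot both be representatives, and a point of S
    separates itself from every other point.  Since c is its own
    representative, S has n - r + 1 elements, which is the bound.

    If the bound is attained, S cannot be shortened.  Suppose that c does not
    separate x from y <> x, let y be the representative of their orbit, and
    remove x from S.  Then {x, y} is the only pair that may fail to be
    separated, and it is therefore separated by no point that stays in the set.
    As the representatives of the other orbits can be chosen freely, this shows
    the key fact [nonseparating_exchange]: if one point fails to separate x
    and y, then no point outside {x, y} separates them.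

    Call x and y twins when some point fails to separate them.  By the key fact
    being twins is a G-invariant equivalence relation, and the orbits of the
    stabilizer of c other than {c} are the twin classes with c removed
    ([stab_orbit_twin_class]).  If G is not regular, no twin class is a
    singleton, so there are r - 1 classes and the stabilizer of c is transitive
    on the rest of the class of c, which gives 2-transitivity.  Finally an
    element of a point stabilizer carries each point to a twin, hence fixes all
    classes; an element g that fixes the class of b agrees at b with an element
    of some point stabilizer, hence fixes all classes as well
    ([twins_fixing_class]): the action on the classes is regular. *)

Set Implicit Arguments.
Unset Strict Implicit.
Unset Printing Implicit Defensive.

Local Open Scope group_scope.

(** * One-fold transitivity *)

Lemma transitive_ntransitive1 (gT : finGroupType) (sT : finType)
    (to : {action gT &-> sT}) (A : {set gT}) (S : {set sT}) :
  [transitive A, on S | to] -> [transitive^1 A, on S | to].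
Proof.
have dtuple1 x : ([tuple x] \in 1.-dtuple(S)) = (x \in S).
  by rewrite dtuple_on_add !inE memtE subset_all andbT.
case/imsetP=> x Sx defS; apply/imsetP; exists [tuple x]; first by rewrite dtuple1.
apply/setP; case/tupleP=> y t; rewrite {t}(tuple0 t) dtuple1 defS.
by apply/imsetP/imsetP=> [[g ? ->] | [g ? [->]]]; exists g => //; apply: val_inj.
Qed.

(** * Separation of points *)

Section Separation.

Variables (T : finType) (G : {group {perm T}}).
Implicit Types (c w x y z : T) (g h : {perm T}) (S : {set T}).

Lemma stab_orbitP c w w' :
  reflect (exists g, [/\ g \in G, g c = c & g w = w']) (w' \in stab_orbit G c w).
Proof.
apply: (iffP orbitP) => [[g /setIP[Gg /astab1P gc] gw] | [g [Gg gc gw]]].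
  by exists g.
by exists g => //; apply/setIP; split=> //; apply/astab1P.
Qed.

Lemma stab_orbit_refl c w : w \in stab_orbit G c w.
Proof. exact: orbit_refl. Qed.

Lemma stab_orbit_self c : stab_orbit G c c = [set c].
Proof.
apply/setP=> w; rewrite inE; apply/stab_orbitP/eqP => [[g [_ gc gw]] | ->].
  by rewrite -gw gc.
by exists 1; rewrite group1 perm1.
Qed.

Lemma stab_orbit_conj c w g :
  g \in G -> stab_orbit G (g c) (g w) = [set g x | x in stab_orbit G c w].
Proof.
move=> Gg; apply/setP=> x; apply/stab_orbitP/imsetP.
  case=> h [Gh hgc hgw]; exists (g^-1 x); last by rewrite permKV.
  apply/stab_orbitP; exists (g * h * g^-1).
  by rewrite !groupM ?groupV // !permM hgc hgw permK.
case=> y /stab_orbitP[h [Gh hc hw] ->]; exists (g^-1 * h * g).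
by rewrite !groupM ?groupV // !permM !permK hc hw.
Qed.

Lemma rank_at_transitive c c' :
  [transitive G, on [set: T] | 'P] -> rank_at G c = rank_at G c'.
Proof.
move=> trG; have [g Gg ->] := atransP2 trG (in_setT c) (in_setT c').
have inj_g : injective (fun A : {set T} => [set g x | x in A]).
  by apply: imset_inj; apply: perm_inj.
rewrite /rank_at -(card_imset _ inj_g); apply: eq_card => A.
apply/imsetP/imsetP => [[_ /imsetP[w _ ->] ->] | [w _ ->]].
  by exists (g w); rewrite //= /aperm stab_orbit_conj.
exists (stab_orbit G c (g^-1 w)); first exact: imset_f.
by rewrite -stab_orbit_conj // permKV.
Qed.

Lemma separatesPn c x y :
  reflect (exists g, [/\ g \in G, g c = c & g x = y]) (~~ separates G c x y).
Proof.
rewrite /separates negbK; apply: (iffP eqP) => [eq_xy | cxy].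
  by apply/stab_orbitP; rewrite eq_xy stab_orbit_refl.
by apply/orbit_in_eqP; rewrite ?subsetT // orbit_in_sym ?subsetT //; apply/stab_orbitP.
Qed.

Lemma separates_sym c x y : separates G c x y = separates G c y x.
Proof. by rewrite /separates eq_sym. Qed.

Lemma nonseparating_trans c y x z :
  ~~ separates G c x y -> ~~ separates G c y z -> ~~ separates G c x z.
Proof. by rewrite /separates !negbK => /eqP->. Qed.

Lemma nonseparating_conj c x y g : g \in G ->
  ~~ separates G c x y -> ~~ separates G (g c) (g x) (g y).
Proof. by rewrite /separates !negbK => Gg /eqP eq_xy; rewrite !stab_orbit_conj ?eq_xy. Qed.

Lemma separates_self x y : x != y -> separates G x x y.
Proof.
by apply: contraR => /separatesPn[g [_ gx gy]]; rewrite -gy gx.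
Qed.

(** A point of S separates itself from every other point, so only the pairs
    outside S matter. *)
Lemma separatingP S :
  (forall x y, x \notin S -> y \notin S -> x != y ->
     exists2 c, c \in S & separates G c x y) ->
  separating G S.
Proof.
move=> sepS; apply/forallP=> x; apply/forallP=> y; apply/implyP=> neq_xy.
apply/existsP; case: (boolP (x \in S)) => [Sx | S'x].
  by exists x; rewrite Sx separates_self.
case: (boolP (y \in S)) => [Sy | S'y].
  by exists y; rewrite Sy separates_sym separates_self // eq_sym.
by have [c Sc sep_c] := sepS x y S'x S'y neq_xy; exists c; rewrite Sc.
Qed.

Lemma orbit_dimension_le S : separating G S -> orbit_dimension G <= #|S|.
Proof.
rewrite /orbit_dimension; case: arg_minnP => [|M _ minM]; last exact: minM.
exact: separatingT.
Qed.

(** * Representatives of the orbits of a point stabilizer *)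

Section Representatives.

Variables (c : T) (rep : {set T} -> T).
Hypothesis rep_in : forall w, rep (stab_orbit G c w) \in stab_orbit G c w.

Definition non_representatives := [set w | rep (stab_orbit G c w) != w].

Lemma stab_orbit_rep w :
  stab_orbit G c (rep (stab_orbit G c w)) = stab_orbit G c w.
Proof. by apply/esym/eqP; rewrite -[_ == _]negbK; apply/separatesPn/stab_orbitP. Qed.

Lemma card_non_representatives : (#|non_representatives| + rank_at G c)%N = #|T|.
Proof.
have -> : rank_at G c = #|~: non_representatives|.
  rewrite /rank_at -(card_in_imset (f := rep)).
    apply: eq_card => w; rewrite !inE negbK.
    apply/imsetP/eqP => [[_ /imsetP[v _ ->] ->] | rep_w].
      by rewrite stab_orbit_rep.
    by exists (stab_orbit G c w); rewrite ?imset_f.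
  by move=> _ _ /imsetP[v _ ->] /imsetP[w _ ->] eq_rep;
    rewrite -stab_orbit_rep eq_rep stab_orbit_rep.
exact: cardsC.
Qed.

Lemma nonseparating_rep x y : ~~ separates G c x y ->
  rep (stab_orbit G c x) = rep (stab_orbit G c y).
Proof. by rewrite negbK => /eqP->. Qed.

Lemma separating_non_representatives :
  separating G (c |: non_representatives).
Proof.
apply: separatingP => x y.
rewrite !inE !negb_or !negbK => /andP[_ /eqP rep_x] /andP[_ /eqP rep_y] neq_xy.
exists c; first by rewrite setU11.
by apply: contraR neq_xy => /nonseparating_rep; rewrite rep_x rep_y => ->.
Qed.

End Representatives.

Lemma orbit_dimension_bound c : (orbit_dimension G <= #|T| - rank_at G c + 1)%N.
Proof.
pose rep (A : {set T}) := odflt c [pick y in A].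
have rep_in w : rep (stab_orbit G c w) \in stab_orbit G c w.
  rewrite /rep; case: pickP => // /(_ w).
  by rewrite stab_orbit_refl.
apply: leq_trans (orbit_dimension_le (separating_non_representatives c rep)) _.
rewrite -(card_non_representatives rep_in) addnK cardsU1 addnC leq_add2l.
exact: leq_b1.
Qed.

(** * Groups attaining the bound *)

Section Extremal.

Hypothesis trG : [transitive G, on [set: T] | 'P].
(** The equality in [orbit_dimension_bound], written without subtraction and for
    all c at once. *)
Hypothesis tight : forall c S, separating G S -> #|T| < #|S| + rank_at G c.

(** If d separated x and y, then x could be dropped from the separating set made
    of c and of the non-representatives of its orbits, for representatives that
    include y and avoid d: the point d would remain in the set and take care of
    the pair {x, y}. Such representatives exist unless the stabilizer of c fixes
    d, but then an element of it that maps x to y shows that d does not separate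
    them. *)
Lemma nonseparating_exchange c d x y : x != y -> ~~ separates G c x y ->
  d != x -> d != y -> ~~ separates G d x y.
Proof.
move=> neq_xy c_xy d'x d'y; apply/negP=> sep_d.
have moved_d : exists2 d', d' != d & d' \in stab_orbit G c d.
  have [g [Gg gc gx]] := separatesPn c x y c_xy.
  exists (g d); last by apply/stab_orbitP; exists g.
  by apply: contraL sep_d => /eqP gd; apply/separatesPn; exists g.
pose rep (A : {set T}) := if y \in A then y else odflt y [pick z in A :\ d].
have rep'd A : rep A != d.
  rewrite /rep; case: ifP => _; first by rewrite eq_sym.
  by case: pickP => [z /setD1P[] | _] //=; rewrite eq_sym.
have rep_in w : rep (stab_orbit G c w) \in stab_orbit G c w.
  rewrite /rep; case: ifP => // _; case: pickP => [z /setD1P[] // | no_z].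
  have [eq_wd | w'd] := eqVneq w d.
    have [d' d'd cd'] := moved_d.
    by have := no_z d'; rewrite !inE d'd eq_wd cd'.
  by have := no_z w; rewrite !inE w'd stab_orbit_refl.
have rep_y : rep (stab_orbit G c y) = y by rewrite /rep stab_orbit_refl.
have rep_x : rep (stab_orbit G c x) = y by rewrite (nonseparating_rep rep c_xy).
pose N := non_representatives c rep; pose S := c |: N :\ x.
have Nx : x \in N by rewrite inE rep_x eq_sym.
have Sd : d \in S by rewrite !inE d'x rep'd orbT.
suffices sepS : separating G S.
  have := tight c sepS; rewrite -(card_non_representatives rep_in) -/N ltn_add2r.
  by rewrite (cardsD1 x N) Nx ltnNge cardsU1 leq_add2r leq_b1.
have fixed w : w \notin S -> w != x -> rep (stab_orbit G c w) = w.
  by rewrite !inE => + w'x; rewrite w'x negb_or negbK => /andP[_ /eqP].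
(* In the orbit of x, the only point outside S other than x is y. *)
have only_y w : w \notin S -> w != x -> ~~ separates G c x w -> w = y.
  by move=> S'w w'x /(nonseparating_rep rep); rewrite rep_x fixed.
apply: separatingP => w w' S'w S'w' neq_w.
have [sep_c | c_w] := boolP (separates G c w w').
  by exists c; rewrite ?setU11.
exists d => //; have [eq_wx | w'x] := eqVneq w x.
  by rewrite eq_wx in c_w neq_w *; rewrite (only_y w') // eq_sym.
have [eq_w'x | w''x] := eqVneq w' x.
  rewrite eq_w'x separates_sym in c_w; rewrite eq_w'x separates_sym.
  by rewrite (only_y w).
by case/eqP: neq_w; have := nonseparating_rep rep c_w; rewrite !fixed.
Qed.

(** * The twin relation *)

Definition twins x y := [exists c, ~~ separates G c x y].

Lemma twinsP x y :
  reflect (exists c, ~~ separates G c x y) (twins x y).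
Proof. exact: existsP. Qed.

Lemma twins_refl x : twins x x.
Proof. by apply/twinsP; exists x; rewrite /separates negbK. Qed.

Lemma twins_sym x y : twins x y = twins y x.
Proof. by apply: eq_existsb => c; rewrite separates_sym. Qed.

Lemma twins_nonseparating c x y :
  twins x y -> c != x -> c != y -> ~~ separates G c x y.
Proof.
have [-> _ _ _ | neq_xy /twinsP[d d_xy]] := eqVneq x y.
  by rewrite /separates negbK.
exact: nonseparating_exchange d_xy.
Qed.

(** A point outside {x, y, z} separates neither x from y nor y from z, hence it
    does not separate x from z. To find such a point or to do without it, take
    an element h of the stabilizer of z that maps x to y. It carries the pair
    {y, z}, which x does not separate, to {h y, z}, which y does not separate:
    either h y = x, so that y does not separate x from z, or h y is outside
    {x, y, z}. *)
Lemma twins_trans y x z : twins x y -> twins y z -> twins x z.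
Proof.
move=> t_xy t_yz.
have [-> | neq_xz] := eqVneq x z; first exact: twins_refl.
have [-> // | neq_xy] := eqVneq x y.
have [<- // | neq_yz] := eqVneq y z.
have fourth c : c != x -> c != y -> c != z -> twins x z.
  move=> c'x c'y c'z; apply/twinsP; exists c.
  by apply: (nonseparating_trans (y := y)); apply: twins_nonseparating.
have z_xy : ~~ separates G z x y by apply: twins_nonseparating; rewrite // eq_sym.
have x_yz : ~~ separates G x y z by apply: twins_nonseparating.
have [h [Gh hz hx]] := separatesPn z x y z_xy.
have := nonseparating_conj Gh x_yz; rewrite hx hz => y_hyz.
have [eq_hy | hy'x] := eqVneq (h y) x.
  by apply/twinsP; exists y; rewrite -eq_hy.
apply: (fourth (h y)) => //.
  by rewrite -{2}hx (inj_eq perm_inj) eq_sym.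
by rewrite -[z]hz (inj_eq perm_inj).
Qed.

Lemma twins_conj g x y : g \in G -> twins x y -> twins (g x) (g y).
Proof.
move=> Gg /twinsP[c c_xy]; apply/twinsP; exists (g c).
exact: nonseparating_conj.
Qed.

Lemma twins_stab c g x : g \in G -> g c = c -> twins x (g x).
Proof. by move=> Gg gc; apply/twinsP; exists c; apply/separatesPn; exists g. Qed.

(** If c does not separate b from g b, then g is the product of an element
    fixing b and an element fixing c, and an element that fixes some point
    carries every point to a twin. *)
Lemma twins_fixing_class g b x : g \in G -> twins b (g b) -> twins x (g x).
Proof.
move=> Gg /twinsP[c /separatesPn[h [Gh hc hb]]].
have fix_b : (g * h^-1) b = b by rewrite permM -hb permK.
apply: twins_trans (twins_stab x (groupM Gg (groupVr Gh)) fix_b) _.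
by rewrite permM -{2}(permKV h (g x)); apply: twins_stab hc.
Qed.

(** * The classes of twins *)

Definition twin_class x := [set y | twins x y].
Definition twin_classes := [set twin_class x | x : T].

Lemma twin_class_eq x y : twins x y -> twin_class x = twin_class y.
Proof.
move=> t_xy; apply/setP=> z; rewrite !inE.
by apply/idP/idP; apply: twins_trans; rewrite // twins_sym.
Qed.

Lemma twin_class_conj g x :
  g \in G -> ('P^*)%act (twin_class x) g = twin_class (g x).
Proof.
move=> Gg; apply/setP=> y; apply/imsetP/idP => [[z] | ].
  by rewrite !inE => t_xz ->; apply: twins_conj.
rewrite inE => t_gxy; exists (g^-1 y); last by rewrite /= /aperm permKV.
by rewrite inE -[x](permK g) twins_conj ?groupV.
Qed.

Lemma twin_classes_partition : invariant_partition G twin_classes.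
Proof.
apply/andP; split.
  have -> : twin_classes = equivalence_partition twins [set: T].
    apply/setP=> A; apply/imsetP/imsetP => [] [x _ ->];
      by exists x; rewrite ?inE //; apply/setP=> y; rewrite !inE.
  apply: equivalence_partitionP => x y z _ _ _; split; first exact: twins_refl.
  move=> t_xy; apply/idP/idP; apply: twins_trans => //.
  by rewrite twins_sym.
apply/actsP=> g Gg A; apply/imsetP/imsetP => [[x _] | [x _ ->]].
  move=> gA; exists (g^-1 x) => //.
  by rewrite -twin_class_conj ?groupV // -gA actK.
by exists (g x); rewrite ?twin_class_conj.
Qed.

(** The stabilizer of c carries each point to a twin; conversely c does not
    separate two twins other than c, since [nonseparating_exchange] lets it take
    the role of any point that fails to separate them. *)
Lemma stab_orbit_twin_class c w :
  w != c -> stab_orbit G c w = twin_class w :\ c.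
Proof.
move=> w'c; apply/setP=> x; rewrite !inE.
apply/stab_orbitP/andP => [[g [Gg gc gw]] | [x'c t_wx]].
  split; last by rewrite -gw; apply: twins_stab gc.
  by rewrite -gw -[c]gc (inj_eq perm_inj).
by apply/separatesPn; apply: twins_nonseparating; rewrite // eq_sym.
Qed.

(** Elements of point stabilizers fix every class, so by [twins_fixing_class] an
    element of G fixing one class fixes them all. *)
Lemma regular_twin_classes :
  regular_on (induced_perms G twin_classes) twin_classes.
Proof.
have /andP[_ actsG] := twin_classes_partition.
have norm_g g : g \in G -> actperm 'P^* g \in 'N(twin_classes | 'P).
  move=> Gg; apply/astabsP=> A.
  by rewrite /= /aperm actpermE (actsP actsG g Gg A).
have inducedE g x : g \in G ->
    restr_perm twin_classes (actperm 'P^* g) (twin_class x) = twin_class (g x).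
  move=> Gg; rewrite restr_permE ?norm_g ?imset_f //.
  by rewrite actpermE twin_class_conj.
have inducedP p : reflect
    (exists2 g, g \in G & p = restr_perm twin_classes (actperm 'P^* g))
    (p \in induced_perms G twin_classes).
  apply: (iffP morphimP) => [[_ _ /morphimP[g _ Gg ->] ->] | [g Gg ->]].
    by exists g.
  exists (actperm 'P^* g) => //; first exact: norm_g.
  by rewrite mem_morphim ?inE.
apply/andP; split.
  apply/imsetP; have [x _ _] := imsetP trG.
  exists (twin_class x); first exact: imset_f.
  apply/setP=> A; apply/imsetP/orbitP => [[y _ ->] | [p /inducedP[g Gg ->] <-]].
    have [g Gg ->] := atransP2 trG (in_setT x) (in_setT y).
    exists (restr_perm twin_classes (actperm 'P^* g)); last exact: inducedE.
    by apply/inducedP; exists g.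
  by exists (g x) => //; apply: inducedE.
apply/forall_inP=> _ /imsetP[b _ ->]; apply/eqP/trivgP/subsetP=> p.
case/setIP=> /inducedP[g Gg ->] /astab1P; rewrite /= /aperm inducedE // => fix_b.
have t_b : twins b (g b).
  by have /setP/(_ (g b)) := fix_b; rewrite !inE twins_refl.
apply/set1P/permP=> A; rewrite perm1.
have [/imsetP[x _ ->] | Cl'A] := boolP (A \in twin_classes).
  rewrite inducedE //; apply/esym/twin_class_eq.
  exact: twins_fixing_class t_b.
by rewrite (out_perm (restr_perm_on _ _)).
Qed.

(** * Non-regular groups *)

Hypothesis not_regular : ~~ regular_on G [set: T].

(** A nontrivial element of a point stabilizer moves some point to a twin, and
    transitivity spreads this to all points. *)
Lemma twin_exists c : exists2 w, w != c & twins c w.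
Proof.
have [x [y x'y t_xy]] : exists x, exists2 y, y != x & twins x y.
  move: not_regular; rewrite negb_and trG => /forall_inPn[b _ /trivgPn[g]].
  case/setIP=> Gg /astab1P gb nt_g.
  have [x gx'x] : exists x, g x != x.
    apply/existsP; apply: contraR nt_g; rewrite negb_exists => /forallP fix_g.
    by apply/eqP/permP=> x; apply/eqP; rewrite perm1 -[_ == _]negbK.
  by exists x, (g x) => //; apply: twins_stab gb.
have [g Gg ->] := atransP2 trG (in_setT x) (in_setT c).
by exists (g y); rewrite ?(inj_eq perm_inj) // twins_conj.
Qed.

(** [stab_orbit_self] and [stab_orbit_twin_class] describe all the orbits:
    removing c from each class gives the ones other than {c}. This is a
    bijection because the class of c does not become empty. *)
Lemma card_twin_classes c : #|twin_classes| = (rank_at G c - 1)%N.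
Proof.
have nonempty x : exists2 w, w != c & twin_class x = twin_class w.
  have [-> | x'c] := eqVneq x c; last by exists x.
  by have [w w'c t_cw] := twin_exists c; exists w; rewrite ?(twin_class_eq t_cw).
have inj_D1 : {in twin_classes &, injective (fun A => A :\ c)}.
  move=> _ _ /imsetP[x _ ->] /imsetP[y _ ->].
  have [w w'c ->] := nonempty x => /setP/(_ w).
  by rewrite !inE w'c twins_refl /= => /esym/twin_class_eq.
rewrite -(card_in_imset inj_D1) /rank_at.
set orbits := [set _ | _ : _].
have orbit_c : [set c] \in orbits by rewrite -stab_orbit_self imset_f.
rewrite (cardsD1 [set c] orbits) orbit_c add1n subn1 /=.
apply: eq_card => A; apply/imsetP/setD1P => [[_ /imsetP[x _ ->] ->] | ].
  have [w w'c ->] := nonempty x; split.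
    apply/eqP=> /setP/(_ w).
    by rewrite !inE (negPf w'c) twins_refl.
  by rewrite -stab_orbit_twin_class // imset_f.
case=> A'c /imsetP[w _ def_A].
have w'c : w != c.
  by apply: contraNneq A'c => eq_wc; rewrite def_A eq_wc stab_orbit_self.
by exists (twin_class w); rewrite ?imset_f // def_A stab_orbit_twin_class.
Qed.

(** An element of G mapping b to a twin stabilizes the class of b, so the
    stabilizer of the class is transitive on it and contains the stabilizer of
    b, one of whose orbits is the class with b removed. *)
Lemma twin_class_2transitive B :
  B \in twin_classes -> [transitive^2 'N_G(B | 'P), on B | 'P].
Proof.
case/imsetP=> b _ ->.
have mem_norm g : g \in G -> twins b (g b) -> g \in 'N_G(twin_class b | 'P).
  move=> Gg t_b; apply/setIP; split=> //.
  apply/astabsP=> x; rewrite !inE /= /aperm.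
  have t_x := twins_fixing_class x Gg t_b.
  by apply/idP/idP=> t_bx; apply: twins_trans t_bx _; rewrite // twins_sym.
have b_in : b \in twin_class b by rewrite inE twins_refl.
apply: (stab_ntransitiveI b_in).
  apply/imsetP; exists b => //.
  apply/setP=> x; apply/idP/orbitP => [ | [g /setIP[_ Ng] <-]]; last first.
    by rewrite (astabs_act _ Ng).
  rewrite inE => t_bx.
  have [g Gg def_x] := atransP2 trG (in_setT b) (in_setT x).
  by exists g => //; apply: mem_norm; rewrite // -[g b]def_x.
have [w w'b t_bw] := twin_exists b.
have w_in : w \in twin_class b :\ b by rewrite !inE w'b.
apply: transitive_ntransitive1; apply/imsetP; exists w => //.
have orbit_w : stab_orbit G b w = twin_class b :\ b.
  by rewrite stab_orbit_twin_class // (twin_class_eq t_bw).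
rewrite -orbit_w; apply/setP=> x; apply/stab_orbitP/orbitP.
  case=> g [Gg gb gw]; exists g => //; apply/setIP; split; last exact/astab1P.
  by apply: mem_norm; rewrite // gb twins_refl.
by case=> g /setIP[/setIP[Gg _] /astab1P gb] gw; exists g.
Qed.

End Extremal.

End Separation.

Theorem theorem1p1 (T : finType) (G : {group {perm T}}) (n r : nat) (a : T)
  (hn : #|T| = n)
  (hG : [transitive G, on [set: T] | 'P])
  (hr : rank_at G a = r) :
  (orbit_dimension G <= n - r + 1)%N /\
  (orbit_dimension G = (n - r + 1)%N ->
   ~~ regular_on G [set: T] ->
   exists Sigma : {set {set T}},
     [/\ invariant_partition G Sigma,
         #|Sigma| = (r - 1)%N,
         forall B : {set T}, B \in Sigma ->
           [transitive^2 'N_G(B | 'P), on B | 'P]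
       & regular_on (induced_perms G Sigma) Sigma]).
Proof.
subst n r; split; first exact: orbit_dimension_bound.
move=> dimG not_reg.
have tight c S : separating G S -> #|T| < #|S| + rank_at G c.
  move/orbit_dimension_le; rewrite dimG (rank_at_transitive c a hG).
  rewrite addn1 -(ltn_add2r (rank_at G a)); apply: leq_ltn_trans.
  by rewrite addnC -leq_subLR.
exists (twin_classes G); split.
- exact: twin_classes_partition.
- exact: card_twin_classes.
- exact: twin_class_2transitive.
- exact: regular_twin_classes.
Qed.
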